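(* Let $D$ and $\Delta$ be constants ($O(1)$). There is a threshold $\varepsilon_{**}>0$ depending only on $D$ and $\Delta$, with $\varepsilon_{**}<\frac1{2\Delta-1}$ and $\varepsilon_{**}=O\big(\min\{1/D,(D/\Delta)^{\Delta/2}\}\big)$, such that every PEPS with bond dimension $D$ on a finite graph of maximum degree $\Delta$ and with injectivity parameter $\varepsilon<\varepsilon_{**}$ satisfies decay of loops: there is a constant $c>c_0:=\log(2e\Delta)+\frac12$ such that $$|Z_\ell|\le e^{-c|\ell|}\qquad\text{for every loop }\ell .$$
   Context: PEPS. $G=(V,E)$ is a finite graph, $\mathcal N(v)$ the neighbors of $v$. A PEPS assigns to each $v$ a linear map $T_v:\bigotimes_{n\in\mathcal N(v)}\mathcal H_{(n,v)}\to\mathcal H_v$ with $\mathcal H_{(n,v)}\cong\mathbb C^D$ and $\mathcal H_v$ finite-dimensional. Each $T_v$ is normalized to have largest singular value $1$; the PEPS has injectivity parameter $\varepsilon=1-\delta^2$ if all singular values of all $T_v$ lie in $[\delta,1]$, $\delta\in(0,1]$. BP fixed point. $\mathcal K_G$ is the set of families $\boldsymbol\mu=(\mu_{\vec e})$ of positive semidefinite trace-one operators on $\mathbb C^D$, one per directed edge. Let $E_v(\bigotimes_nX_n)=\mathrm{Tr}[T_v(\bigotimes_nX_n)T_v^\dagger]$ be the double-layer tensor, and $b(X,Y)=\sum_{ij}X_{ij}Y_{ij}$ the bilinear pairing describing contraction of a double-layer bond. $\Phi_{(v,n)}(X)$ is the operator on $\mathbb C^D$ defined by $b(\Phi_{(v,n)}(X),Y)=E_v(X\otimes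 Y)$, $Y$ placed on leg $n$ and $X$ on the other legs. $\boldsymbol\mu$ is a BP fixed point if $\mu_{(v,n)}=\Phi_{(v,n)}(\bigotimes_{m\in\mathcal N(v)\setminus\{n\}}\mu_{(m,v)})/\mathrm{Tr}[\cdot]$ for every directed edge $(v,n)$. For $\varepsilon<1/(2\Delta-1)$ it exists and is unique; it is the one used below. Loops. The norm network is the contraction of all $E_v$ along the edges of $G$. For an edge $e=\{v,w\}$ let $I_e=b(\mu_{(v,w)},\mu_{(w,v)})$, let $P_e(Y)=\frac{b(\mu_{(w,v)},Y)}{I_e}\mu_{(v,w)}$ (a rank-one projector on the bond operator space, in orientation $v\to w$) and $P_e^\perp=\mathrm{id}-P_e$. $\mathcal Z_{\mathrm{BP}}$ is the contraction of the norm network with $P_e$ inserted on every edge. A loop $\ell=(W,F)$ is a connected subgraph of $G$ in which every vertex has degree at least $2$; $|\ell|=|F|$ is its number of edges. The loop activity $Z_\ell$ is the contraction with $P_e^\perp$ inserted on the edges $e\in F$ and $P_e$ inserted on all other edges, divided by $\mathcal Z_{\mathrm{BP}}$. *)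

(* Defs.v *)
From HB Require Import structures.
From mathcomp Require Import all_boot all_order all_algebra.
From mathcomp Require Import reals.
From mathcomp Require Import complex.
From mathcomp Require Import sesquilinear spectral.

Set Implicit Arguments.
Unset Strict Implicit.
Unset Printing Implicit Defensive.

Import Order.TTheory GRing.Theory Num.Theory.
Local Open Scope ring_scope.
Local Open Scope complex_scope.
Local Open Scope sesquilinear_scope.

Record sgraph := SGraph {
  vertex :> finType;
  adj : rel vertex;
  adj_sym : symmetric adj;
  adj_irr : irreflexive adj }.

Section Graph.
Variable G : sgraph.

Definition nbr (v : G) : finType := {n : G | adj v n}.

Definition max_degree : nat := \max_(v : G) #|nbr v|.

(* Directed edges (source, target). *)
Definition dart : finType := {p : G * G | adj p.1 p.2}.

Definition src (d : dart) : G := (val d).1.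
Definition tgt (d : dart) : G := (val d).2.

Definition leg (v : G) (n : nbr v) : dart :=
  exist (fun p : G * G => adj p.1 p.2) (v, val n) (valP n).

Lemma flip_subproof (d : dart) : adj (tgt d) (src d).
Proof. by rewrite adj_sym; exact: (valP d). Qed.

Definition flip (d : dart) : dart :=
  exist (fun p : G * G => adj p.1 p.2) (tgt d, src d) (flip_subproof d).

Definition edge_of (d : dart) : {set G} := [set src d; tgt d].

Definition edges : {set {set G}} := [set edge_of d | d : dart].

Definition is_subgraph (W : {set G}) (F : {set {set G}}) : Prop :=
  F \subset edges /\ forall f, f \in F -> f \subset W.

Definition is_connected (W : {set G}) (F : {set {set G}}) : Prop :=
  W != set0 /\
  {in W &, forall x y, connect [rel a b | [set a; b] \in F] x y}.

Definition degree_in (F : {set {set G}}) (v : G) : nat :=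
  #|[set f in F | v \in f]|.

Definition is_loop (W : {set G}) (F : {set {set G}}) : Prop :=
  [/\ is_subgraph W F, is_connected W F
    & forall v, v \in W -> (2 <= degree_in F v)%N].

End Graph.

Section Matrices.
Variable R : realType.
Local Notation C := R[i].

(* All n square roots of eigenvalues of T^* T are counted: when T is not
   injective, 0 is a singular value, even if T is wider than tall. *)
Definition is_singular_value (m n : nat) (T : 'M[C]_(m, n)) (s : R) : Prop :=
  0 <= s /\ eigenvalue (T ^t* *m T) ((s ^+ 2)%:C).

Definition psdmx (n : nat) (A : 'M[C]_n) : Prop :=
  A \is hermsymmx /\ forall x : 'rV[C]_n, 0 <= (x *m A *m x ^t*) 0 0.

(* Bilinear: no complex conjugation. *)
Definition bondpair (n : nat) (X Y : 'M[C]_n) : C :=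
  \sum_i \sum_j X i j * Y i j.

(* The space of functions I -> 'I_D is the basis of the tensor product of
   copies of C^D indexed by I; enum_val and enum_rank number this basis. *)
Definition tens (D : nat) (I : finType) (X : I -> 'M[C]_D) :
    'M[C]_#|{ffun I -> 'I_D}| :=
  \matrix_(a, b) \prod_(n : I)
     X n ((enum_val a : {ffun I -> 'I_D}) n) ((enum_val b : {ffun I -> 'I_D}) n).

End Matrices.

Record peps (R : realType) (G : sgraph) (D : nat) := Peps {
  phys : G -> nat;
  site : forall v : G, 'M[R[i]]_(phys v, #|{ffun nbr v -> 'I_D}|) }.

Section PEPS.
Variables (R : realType) (G : sgraph) (D : nat) (A : peps R G D).
Local Notation C := R[i].

Definition normalized : Prop :=
  forall v : G, is_singular_value (site A v) 1 /\
    forall s : R, is_singular_value (site A v) s -> s <= 1.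

Definition injectivity_parameter (eps : R) : Prop :=
  exists delta : R,
    [/\ 0 < delta <= 1, eps = 1 - delta ^+ 2 &
        forall (v : G) (s : R),
          is_singular_value (site A v) s -> delta <= s <= 1].

Definition double_layer (v : G) (X : 'M[C]_#|{ffun nbr v -> 'I_D}|) : C :=
  \tr (site A v *m X *m (site A v) ^t*).

Definition set_leg (v : G) (n : nbr v) (X : nbr v -> 'M[C]_D) (Y : 'M[C]_D) :
    nbr v -> 'M[C]_D :=
  fun m => if m == n then Y else X m.

(* The value X n on the outgoing leg is ignored.  See bondpair_Phi. *)
Definition Phi (v : G) (n : nbr v) (X : nbr v -> 'M[C]_D) : 'M[C]_D :=
  \matrix_(i, j) double_layer (tens (set_leg n X (delta_mx i j))).

Lemma bondpair_Phi (v : G) (n : nbr v) (X : nbr v -> 'M[C]_D) (Y : 'M[C]_D) :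
  bondpair (Phi n X) Y = double_layer (tens (set_leg n X Y)).
Proof.
have -> : tens (set_leg n X Y) =
    \sum_i \sum_j Y i j *: tens (set_leg n X (delta_mx i j)).
  apply/matrixP => a b; rewrite summxE mxE (bigD1 n) //= {1}/set_leg eqxx.
  set r := \prod_(_ | _) _.
  have rE i j : tens (set_leg n X (delta_mx i j)) a b =
      delta_mx i j ((enum_val a : {ffun nbr v -> 'I_D}) n)
                   ((enum_val b : {ffun nbr v -> 'I_D}) n) * r.
    rewrite mxE (bigD1 n) //= {1}/set_leg eqxx; congr (_ * _).
    by apply: eq_bigr => m /negbTE mn; rewrite /set_leg mn.
  rewrite {1}(matrix_sum_delta Y) summxE mulr_suml; apply: eq_bigr => i _.
  rewrite !summxE mulr_suml; apply: eq_bigr => j _.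
  by rewrite [RHS]mxE rE mxE mulrA.
rewrite /double_layer mulmx_sumr mulmx_suml raddf_sum; apply: eq_bigr => i _.
rewrite mulmx_sumr mulmx_suml raddf_sum; apply: eq_bigr => j _.
by rewrite mxE -scalemxAr -scalemxAl /= mxtraceZ mulrC.
Qed.

Definition message_family (mu : dart G -> 'M[C]_D) : Prop :=
  forall d, psdmx (mu d) /\ \tr (mu d) = 1.

Definition bp_fixed_point (mu : dart G -> 'M[C]_D) : Prop :=
  message_family mu /\
  forall (v : G) (n : nbr v),
    let X := Phi n (fun m => mu (flip (leg m))) in
    mu (leg n) = (\tr X)^-1 *: X.

(* Contraction of all double-layer tensors along the edges, the operator
   L d being inserted on the bond d.  Each end of an edge carries a double
   (ket, bra) index; c d is the one at src d.  Each undirected edge is taken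
   once, oriented by the enumeration of the vertices; the choice is
   immaterial for the projectors below, whose versions for d and flip d are
   transposes of each other under bondpair. *)
Definition contraction (L : dart G -> 'M[C]_D -> 'M[C]_D) : C :=
  \sum_(c : {ffun dart G -> 'I_D * 'I_D})
    (\prod_(v : G)
       double_layer (tens (fun n : nbr v =>
         delta_mx (c (leg n)).1 (c (leg n)).2))) *
    (\prod_(d : dart G | (enum_rank (src d) < enum_rank (tgt d))%N)
       (L d (delta_mx (c d).1 (c d).2)) (c (flip d)).1 (c (flip d)).2).

Definition bp_proj (mu : dart G -> 'M[C]_D) (d : dart G) (Y : 'M[C]_D) :
    'M[C]_D :=
  (bondpair (mu (flip d)) Y / bondpair (mu d) (mu (flip d))) *: mu d.

Definition bp_proj_perp (mu : dart G -> 'M[C]_D) (d : dart G) (Y : 'M[C]_D) :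
    'M[C]_D :=
  Y - bp_proj mu d Y.

Definition Z_BP (mu : dart G -> 'M[C]_D) : C := contraction (bp_proj mu).

Definition loop_activity (mu : dart G -> 'M[C]_D) (F : {set {set G}}) : C :=
  contraction (fun d => if edge_of d \in F then bp_proj_perp mu d
                        else bp_proj mu d) / Z_BP mu.

End PEPS.

(* Main.v *)
Require Import Defs.
From mathcomp Require Import all_boot all_order all_algebra.
From mathcomp Require Import reals sequences exp.
From mathcomp Require Import complex.
From mathcomp Require Import sesquilinear spectral ring lra.
Import Order.TTheory GRing.Theory Num.Theory.
Local Open Scope ring_scope.
Local Open Scope complex_scope.

(* The singular value bounds give |T_v^* T_v - 1| = O(eps), so contracting the
   site v against X_n is within O(eps) of the product of the traces tr X_n, and
   the messages are within O(eps) of 1/D.  As P^perp is idempotent, each edge of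
   the loop can be cut into a sum of at most D^2 products of two operators, one
   for each end, both orthogonal (for the bond pairing) to the message leaving
   that end.  After the cut Z_l is a sum of products over the vertices; the
   vertices off the loop contribute exactly as to Z_BP and cancel.  At a vertex
   of the loop some leg carries an operator orthogonal to a message close to
   1/D, hence of trace O(eps), so the vertex contributes O(eps).  Hence
   |Z_l| <= C1^|F| (C2 eps)^|W| with C1, C2 depending on D and Delta only, and
   |F| <= Delta |W|. *)

Set Implicit Arguments.
Unset Strict Implicit.
Unset Printing Implicit Defensive.

(** * Expansion of the loop activity over the vertices *)

Section Darts.
Variable G : sgraph.

Definition nbr_of (d : dart G) : nbr (src d) :=
  exist (fun n => adj (src d) n) (tgt d) (valP d).

Lemma nbr_ofK (d : dart G) : leg (nbr_of d) = d.
Proof. by apply: val_inj; case: d => -[]. Qed.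

Lemma legK (v : G) (n : nbr v) : nbr_of (leg n) = n.
Proof. exact: val_inj. Qed.

Lemma flipK : involutive (@flip G).
Proof. by move=> d; apply: val_inj; case: d => -[]. Qed.

Lemma edge_of_flip (d : dart G) : edge_of (flip d) = edge_of d.
Proof. by rewrite /edge_of setUC. Qed.

(** The orientation built into [contraction]: exactly one of [d] and [flip d] satisfies it. *)
Definition oriented (d : dart G) : bool := (enum_rank (src d) < enum_rank (tgt d))%N.

Lemma oriented_flip (d : dart G) : oriented (flip d) = ~~ oriented d.
Proof.
rewrite /oriented /= -leqNgt ltn_neqAle; case: eqP => //= /val_inj/enum_rank_inj e.
have : adj (src d) (tgt d) := valP d.
by rewrite (e : tgt d = src d) adj_irr.
Qed.

(** Two darts on the same edge with different sources are flips of each other, and these cannot both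
    be oriented. *)
Lemma oriented_edge_inj : {in oriented &, injective (@edge_of G)}.
Proof.
move=> d d' od od' e.
have [|] := eqVneq (src d) (src d') => s.
  apply: val_inj; rewrite [val d]surjective_pairing [val d']surjective_pairing.
  rewrite -/(src d) -/(tgt d) -/(src d') -/(tgt d') s; congr (_, _).
  have : tgt d \in edge_of d' by rewrite -e !inE eqxx orbT.
  rewrite !inE => /orP[/eqP t|/eqP//].
  by move: od; rewrite unfold_in /oriented s t ltnn.
have : src d \in edge_of d' by rewrite -e !inE eqxx.
rewrite !inE (negbTE s) /= => /eqP st'.
have : src d' \in edge_of d by rewrite e !inE eqxx.
rewrite !inE eq_sym (negbTE s) /= => /eqP s't.
move: od od'; rewrite !unfold_in /oriented -st' -s't => h1 h2.
by have := ltn_trans h1 h2; rewrite ltnn.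
Qed.

Section BigDart.
Variable C : comNzRingType.

Lemma prod_dart_legs (f : dart G -> C) :
  \prod_d f d = \prod_(v : G) \prod_(n : nbr v) f (leg n).
Proof.
rewrite (sig_big_dep xpredT (fun v n => true) (fun v (n : nbr v) => f (leg n))).
rewrite (reindex (fun p : {v : G & nbr v} => leg (tagged p))) //.
exists (fun d => Tagged (@nbr G) (nbr_of d)) => [[v n] _|d _] /=; last exact: nbr_ofK.
by rewrite legK.
Qed.

Lemma prod_dart_oriented (f : dart G -> C) :
  \prod_d f d = \prod_(d | oriented d) (f d * f (flip d)).
Proof.
rewrite (bigID oriented) big_split /=; congr (_ * _).
rewrite (reindex_inj (inv_inj flipK)); apply: eq_bigl => d /=.
by rewrite oriented_flip negbK.
Qed.

(** Every dart is a leg of exactly one vertex, its source. A labelling of the darts is thus an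
    independent choice of leg labellings at the vertices, and distributivity applies. *)
Lemma sum_dart_legs (X : finType) (f : forall v : G, {ffun nbr v -> X} -> C) :
  \sum_(c : {ffun dart G -> X}) \prod_v f v [ffun n => c (leg n)] =
  \prod_v \sum_(g : {ffun nbr v -> X}) f v g.
Proof.
pose T (v : G) : finType := {ffun nbr v -> X}.
pose f' (v : G) := [ffun g : T v => f v g].
transitivity (\prod_v \sum_(g : T v) f' v g); last first.
  by apply: eq_bigr => v _; apply: eq_bigr => g _; rewrite ffunE.
under [RHS]eq_bigr do rewrite (@big_tag _ _ _ _ T (fun v g => f' v g)).
rewrite bigA_distr_big_dep -big_fprod.
(* The set of leg labellings varies with the vertex, so a dart labelling is matched with an element
   of a dependent product. *)
pose h (c : {ffun dart G -> X}) : fprod T := [fprod v : G => [ffun n => c (leg n)]].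
rewrite (reindex h) /=; last first.
  exists (fun t : fprod T => [ffun d => t (src d) (nbr_of d)]) => [c|t] _.
    by apply/ffunP => d; rewrite ffunE fprodE ffunE nbr_ofK.
  by apply/fprodP => v; rewrite fprodE; apply/ffunP => n; rewrite !ffunE /= legK.
by apply: eq_bigr => c _; apply: eq_bigr => v _; rewrite fprodE ffunE.
Qed.

End BigDart.
End Darts.

(** * Cutting the bonds and factorizing the contraction over the vertices *)

Section Expansion.
Variables (R : realType) (G : sgraph) (D : nat) (A : peps R G D).
Local Notation C := R[i].
Local Notation X := ('I_D * 'I_D)%type.
Local Notation "M .@ x" := (M x.1 x.2) (at level 2).
Local Notation delta x := (delta_mx x.1 x.2).

Lemma eq_tens (I : finType) (Y Z : I -> 'M[C]_D) : Y =1 Z -> tens Y = tens Z.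
Proof. by move=> e; apply/matrixP => a b; rewrite !mxE; apply: eq_bigr => n _; rewrite e. Qed.

Lemma tens_delta_sum (I : finType) (Y : I -> 'M[C]_D) :
  tens Y = \sum_(g : {ffun I -> X}) (\prod_n (Y n).@(g n)) *: tens (fun n => delta (g n)).
Proof.
apply/matrixP => a b; rewrite summxE mxE.
have e n : Y n ((enum_val a : {ffun I -> 'I_D}) n) ((enum_val b : {ffun I -> 'I_D}) n) =
  \sum_(x : X) (Y n).@x * (delta x : 'M[C]_D) ((enum_val a : {ffun I -> 'I_D}) n)
     ((enum_val b : {ffun I -> 'I_D}) n).
  rewrite {1}(matrix_sum_delta (Y n)) summxE.
  rewrite -(pair_bigA _ (fun i j => Y n i j * (delta_mx i j : 'M[C]_D) _ _)) /=.
  by apply: eq_bigr => i _; rewrite summxE; apply: eq_bigr => j _; rewrite mxE.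
under eq_bigr do rewrite e.
rewrite bigA_distr_bigA; apply: eq_bigr => g _.
by rewrite !mxE -big_split.
Qed.

Lemma double_layer_sum (v : G) (Y : nbr v -> 'M[C]_D) :
  double_layer A (tens Y) = \sum_(g : {ffun nbr v -> X})
    double_layer A (tens (fun n => delta (g n))) * \prod_n (Y n).@(g n).
Proof.
rewrite {1}tens_delta_sum /double_layer mulmx_sumr mulmx_suml raddf_sum.
by apply: eq_bigr => g _; rewrite -scalemxAr -scalemxAl /= mxtraceZ mulrC.
Qed.

(** Once every bond carries a product of one factor per end, the bond indices at different vertices
    decouple, and multilinearity reassembles each vertex. Both [Z_BP] and the cut loop contraction
    are evaluated this way. *)
Lemma contraction_product (w : dart G -> 'M[C]_D) :
  \sum_(c : {ffun dart G -> X})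
    (\prod_(v : G) double_layer A (tens (fun n : nbr v => delta (c (leg n))))) *
    \prod_d (w d).@(c d) =
  \prod_(v : G) double_layer A (tens (fun n : nbr v => w (leg n))).
Proof.
under [RHS]eq_bigr do rewrite double_layer_sum.
rewrite -sum_dart_legs; apply: eq_bigr => c _.
rewrite prod_dart_legs -big_split /=; apply: eq_bigr => v _; congr (_ * _).
  by congr double_layer; apply: eq_tens => n; rewrite ffunE.
by apply: eq_bigr => n _; rewrite ffunE.
Qed.

Variable mu : dart G -> 'M[C]_D.

Local Notation I d := (bondpair (mu d) (mu (flip d))).

(** This is [bp_proj_perp mu (flip d)] applied to the matrix unit [z]: the operator placed at the
    [src d] end of a cut edge. *)
Definition perp_factor (d : dart G) (z : X) : 'M[C]_D :=
  delta z - ((mu d).@z / I d) *: mu (flip d).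

Lemma bondpairE (Y Z : 'M[C]_D) : bondpair Y Z = \sum_(x : X) Y.@x * Z.@x.
Proof. by rewrite /bondpair pair_bigA. Qed.

Lemma bondpairC (Y Z : 'M[C]_D) : bondpair Y Z = bondpair Z Y.
Proof. by rewrite !bondpairE; apply: eq_bigr => x _; rewrite mulrC. Qed.

Lemma deltaE (x y : X) : (delta x : 'M[C]_D).@y = (y == x)%:R.
Proof. by rewrite mxE -xpair_eqE -!surjective_pairing. Qed.

Lemma sum_delta (x : X) (f : X -> C) : \sum_y f y * (y == x)%:R = f x.
Proof.
rewrite (bigD1 x) //= eqxx mulr1 big1 ?addr0 // => y /negbTE ->.
by rewrite mulr0.
Qed.

Lemma bondpair_delta (Y : 'M[C]_D) (x : X) : bondpair Y (delta x) = Y.@x.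
Proof.
by rewrite bondpairE -(sum_delta x (fun y => Y.@y)); apply: eq_bigr => y _; rewrite deltaE.
Qed.

Lemma bp_projE (d : dart G) (x y : X) :
  (bp_proj mu d (delta x)).@y = (I d)^-1 * ((mu (flip d)).@x * (mu d).@y).
Proof. by rewrite mxE bondpair_delta -mulrA mulrCA. Qed.

Lemma bondpair_perp_factor (d : dart G) (z : X) :
  I d != 0 -> bondpair (mu d) (perp_factor d z) = 0.
Proof.
move=> I0.
transitivity (bondpair (mu d) (delta z) - (mu d).@z / I d * I d); last first.
  by rewrite bondpair_delta divfK // subrr.
rewrite /perp_factor; move: (_ / I d) => k.
rewrite !bondpairE mulr_sumr -sumrB; apply: eq_bigr => x _.
by rewrite [X in _ * X]mxE [X in _ * (_ + X)]mxE [X in _ * (_ - X)]mxE; ring.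
Qed.

(* [P^perp] is idempotent, so its kernel factors through a middle index [z]
   with both factors annihilated by the messages. *)
Lemma bp_proj_perpE (d : dart G) (x y : X) : I d != 0 ->
  (bp_proj_perp mu d (delta x)).@y =
  \sum_z (perp_factor d z).@x * (perp_factor (flip d) z).@y.
Proof.
move=> I0.
(* Multiply out the two factors. Summed over [z], both cross terms give minus the kernel of the
   projector, and the last term gives it back once because the sum of [(mu d).@z * (mu (flip d)).@z]
   is [I d]. *)
transitivity (\sum_z ((x == z)%:R * (y == z)%:R
     - (mu (flip d)).@x / I d * ((mu d).@z * (y == z)%:R)
     - (mu d).@y / I d * ((mu (flip d)).@z * (x == z)%:R)
     + (mu (flip d)).@x * (mu d).@y / (I d) ^+ 2 * ((mu d).@z * (mu (flip d)).@z)) : C);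
    last first.
  apply: eq_bigr => z _; rewrite /perp_factor !mxE flipK (bondpairC (mu (flip d))).
  rewrite -!xpair_eqE -!surjective_pairing.
  by field.
rewrite big_split sumrB sumrB -!mulr_sumr -bondpairE /=.
under [X in X - _ - _ + _]eq_bigr do rewrite mulrC eq_sym [x == _]eq_sym -[_%:R * _]mulr1.
have sd (u : X) (f : X -> C) : \sum_z f z * (u == z)%:R = f u.
  by under eq_bigr do rewrite eq_sym; exact: sum_delta.
rewrite !sd /bp_proj_perp mxE [in X in _ + X]mxE bp_projE deltaE.
have -> : \sum_z (z == y)%:R * (z == x)%:R * 1 = (y == x)%:R :> C.
  by under eq_bigr do rewrite mulr1; rewrite sum_delta eq_sym.
by field.
Qed.

(** A rank-one projector cuts its bond: each end receives the message arriving there, and the edge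
    leaves a factor [(I d)^-1]. *)
Lemma Z_BPE :
  Z_BP A mu = (\prod_(d | oriented d) (I d)^-1) *
    \prod_(v : G) double_layer A (tens (fun n : nbr v => mu (flip (leg n)))).
Proof.
rewrite -(contraction_product (fun d => mu (flip d))) mulr_sumr.
apply: eq_bigr => c _; rewrite mulrCA; congr (_ * _).
rewrite prod_dart_oriented -big_split /=; apply: eq_bigr => d _.
by rewrite bp_projE flipK.
Qed.

Variable F : {set {set G}}.

(** The two ends of a cut loop edge must share one middle index, so both read [z] at the oriented
    dart of the edge. *)
Definition loop_tensor (z : {ffun dart G -> X}) (d : dart G) : 'M[C]_D :=
  if edge_of d \in F then perp_factor d (z (if oriented d then d else flip d))
  else mu (flip d).

Lemma loop_contractionE (x0 : X) :
  (forall d, edge_of d \in F -> I d != 0) ->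
  contraction A (fun d => if edge_of d \in F then bp_proj_perp mu d else bp_proj mu d) =
  (\prod_(d | oriented d && (edge_of d \notin F)) (I d)^-1) *
  \sum_(z in pffun_on x0 [pred d | oriented d && (edge_of d \in F)] predT)
    \prod_(v : G) double_layer A (tens (fun n : nbr v => loop_tensor z (leg n))).
Proof.
move=> I0.
have cp (z : {ffun dart G -> X}) := esym (contraction_product (loop_tensor z)).
rewrite [X in _ = _ * X](eq_bigr _ (fun z _ => cp z)).
rewrite exchange_big mulr_sumr; apply: eq_bigr => c _ /=.
rewrite -mulr_sumr mulrCA; congr (_ * _).
rewrite -/(@oriented G) (bigID (fun d => edge_of d \in F)) /=.
under eq_bigr => d /andP[_ dF] do rewrite dF bp_proj_perpE ?I0 //.
(* Expand the product over loop edges of sums over the middle index. Fixing the value [x0] off the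
   oriented loop darts makes each choice of middle indices occur once. *)
rewrite (big_distr_big x0) /= mulr_suml mulr_sumr; apply: eq_bigr => z _.
rewrite prod_dart_oriented [X in _ = _ * X](bigID (fun d => edge_of d \in F)) /=.
rewrite mulrCA; congr (_ * _).
  apply: eq_bigr => d /andP[od dF]; have {}od : oriented d := od.
  by rewrite /loop_tensor edge_of_flip dF oriented_flip od /= flipK.
rewrite -big_split /=; apply: eq_bigr => d /andP[_ dF].
by rewrite /loop_tensor edge_of_flip (negbTE dF) bp_projE flipK.
Qed.

(** The factors [(I d)^-1] off the loop cancel between numerator and [Z_BP]. On the loop only [Z_BP]
    has them, whence the product of [I d] over the edges in [F]. *)
Lemma loop_activityE (x0 : X) :
  (forall d, I d != 0) ->
  loop_activity A mu F =
  (\prod_(d | oriented d && (edge_of d \in F)) I d) *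
  \sum_(z in pffun_on x0 [pred d | oriented d && (edge_of d \in F)] predT)
    \prod_(v : G) (double_layer A (tens (fun n : nbr v => loop_tensor z (leg n))) /
      double_layer A (tens (fun n : nbr v => mu (flip (leg n))))).
Proof.
move=> I0; rewrite /loop_activity (loop_contractionE x0) // Z_BPE.
rewrite [in X in _ / X](bigID (fun d => edge_of d \in F)) /=.
under [X in _ = _ * X]eq_bigr do rewrite prodf_div.
rewrite -mulr_suml !prodfV !invfM !invrK.
set a := \prod_(_ | _ && (_ \notin _)) _; set b := \prod_(_ | _ && _) _.
have a0 : a != 0 by exact/prodf_neq0.
by rewrite mulrACA (mulrC b) mulKf.
Qed.

End Expansion.

(** * Matrix entry bounds *)

Section Modulus.
Variable R : realType.
Local Notation C := R[i].
Local Notation normc := (@ComplexField.Normc.normc R).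

Lemma norm_normc (x : C) : `|x| = (normc x)%:C.
Proof. by case: x. Qed.

Lemma normc_ge0 (x : C) : 0 <= normc x.
Proof. by rewrite -lecR -norm_normc; exact: normr_ge0. Qed.

Lemma normcD (x y : C) : normc (x + y) <= normc x + normc y.
Proof. by rewrite -lecR rmorphD /= -!norm_normc; exact: ler_normD. Qed.

Lemma normcB (x y : C) : normc (x - y) <= normc x + normc y.
Proof. by rewrite -lecR rmorphD /= -!norm_normc; exact: ler_normB. Qed.

Lemma normc_opp (x : C) : normc (- x) = normc x.
Proof. by apply: complexI; rewrite -!norm_normc normrN. Qed.

Lemma normc_sum (I : finType) (P : pred I) (f : I -> C) :
  normc (\sum_(i | P i) f i) <= \sum_(i | P i) normc (f i).
Proof.
rewrite -lecR rmorph_sum /= -norm_normc.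
apply: (le_trans (ler_norm_sum _ _ _)).
by apply: ler_sum => i _; rewrite norm_normc.
Qed.

Lemma normc_prod (I : finType) (P : pred I) (f : I -> C) :
  normc (\prod_(i | P i) f i) = \prod_(i | P i) normc (f i).
Proof.
apply: (big_morph normc (@ComplexField.Normc.normcM R) (ComplexField.Normc.normc1 R)).
Qed.

Lemma normc_sum_le (I : finType) (f : I -> C) (b : R) :
  (forall i, normc (f i) <= b) -> normc (\sum_i f i) <= #|I|%:R * b.
Proof.
move=> fb; apply: (le_trans (normc_sum _ _)).
by rewrite mulr_natl -sumr_const; apply: ler_sum.
Qed.

Lemma normc_conj (x : C) : normc x^* = normc x.
Proof. by case: x => a b; rewrite /= sqrrN. Qed.

Lemma normc_nat (n : nat) : normc n%:R = n%:R.
Proof. by apply: complexI; rewrite -norm_normc rmorph_nat normr_nat. Qed.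

Lemma normc_bool_le1 (b : bool) : normc b%:R <= 1.
Proof. by rewrite normc_nat; case: b. Qed.

End Modulus.

(** * Entries of Gram matrices and of positive semidefinite matrices *)

Section Gram.
Local Open Scope sesquilinear_scope.
Variable R : realType.
Local Notation C := R[i].
Local Notation normc := (@ComplexField.Normc.normc R).

Lemma unitarymx_entry_le1 (n : nat) (P : 'M[C]_n) (k a : 'I_n) :
  P \is unitarymx -> normc (P k a) <= 1.
Proof.
move=> /unitarymxP /matrixP/(_ k k); rewrite !mxE eqxx => e.
have {}e : \sum_j `|P k j| ^+ 2 = 1.
  by rewrite -[1]e; apply: eq_bigr => j _; rewrite !mxE normCK.
rewrite -(@ler_pXn2r _ 2) ?nnegrE ?normc_ge0 // expr1n -lecR rmorphXn /= -norm_normc.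
rewrite -[1%:C]/(1 : C) -e (bigD1 a) //= lerDl.
by apply: sumr_ge0 => j _; rewrite exprn_ge0.
Qed.

(** Diagonalize [T ^t* *m T] by a unitary [P]. The eigenvalues are squares of singular values, hence
    within [1 - delta ^+ 2] of 1, and each entry of the difference is a sum of [n] eigenvalue
    deviations weighted by entries of [P] of modulus at most 1. *)
Lemma gram_close_to_identity (m n : nat) (T : 'M[C]_(m, n)) (delta : R) :
  0 <= delta <= 1 ->
  (forall s, is_singular_value T s -> delta <= s <= 1) ->
  forall a b, normc ((T ^t* *m T) a b - (a == b)%:R) <= n%:R * (1 - delta ^+ 2).
Proof.
move=> /andP[d0 d1] sv a b; set M := T ^t* *m T.
have Mh : M ^t* = M by rewrite /M trmx_mul map_mxM trmxCK.
have /orthomx_spectralP Msp : M \is normalmx by apply/normalmxP; rewrite Mh.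
have Pu := spectral_unitarymx M; move: Msp Pu.
set P := spectralmx M; set d := spectral_diag M => Msp Pu.
rewrite invmx_unitary // in Msp.
have PP : P *m P ^t* = 1%:M by apply/unitarymxP.
have PP' : P ^t* *m P = 1%:M by apply: mulmx1C.
have PM : P *m M = diag_mx d *m P by rewrite Msp !mulmxA PP mul1mx.
have dbound k : normc (d 0 k - 1) <= 1 - delta ^+ 2.
  have dk : d 0 k = (P *m M *m P ^t*) k k.
    by rewrite PM -mulmxA PP mulmx1 mxE eqxx mulr1n.
  have dk0 : 0 <= d 0 k.
    have -> : d 0 k = ((P *m T ^t*) *m (P *m T ^t*) ^t*) k k.
      by rewrite dk trmx_mul map_mxM trmxCK !mulmxA.
    by rewrite mxE; apply: sumr_ge0 => j _; rewrite !mxE -normCK exprn_ge0.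
  have [r r0 dr] : exists2 r : R, 0 <= r & d 0 k = r%:C.
    exists (normc (d 0 k)); first exact: normc_ge0.
    by rewrite -norm_normc ger0_norm.
  (* Row [k] of [P] is an eigenvector; it is nonzero because [P *m P ^t*] has diagonal entry 1. *)
  have /sv/andP[s1 s2] : is_singular_value T (Num.sqrt r).
    split; first exact: sqrtr_ge0.
    rewrite sqr_sqrtr // -dr; apply/eigenvalueP; exists (row k P).
      rewrite -/M -row_mul PM row_mul row_diag_mx -scalemxAl -rowE //.
    apply/eqP => P0; have /matrixP/(_ k k) := PP.
    rewrite mxE [in RHS]mxE eqxx big1; first by move/eqP; rewrite eq_sym oner_eq0.
    by move=> j _; move/rowP: P0 => /(_ j); rewrite !mxE => ->; rewrite mul0r.
  rewrite dr -[1]/(1%:C) -rmorphB /= expr0n /= addr0 sqrtr_sqr.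
  have rE : r = Num.sqrt r ^+ 2 by rewrite sqr_sqrtr.
  by rewrite ler0_norm; rewrite rE; nra.
have -> : M a b - (a == b)%:R =
    \sum_k (P k a)^* * (d 0 k - 1) * P k b.
  have -> : (a == b)%:R = (P ^t* *m P) a b by rewrite PP' mxE.
  rewrite Msp -mulmxA mul_diag_mx !mxE -sumrB; apply: eq_bigr => k _.
  by rewrite !mxE; ring.
rewrite -[n in n%:R]card_ord; apply: normc_sum_le => k.
rewrite !ComplexField.Normc.normcM normc_conj.
have h1 := unitarymx_entry_le1 k a Pu; have h2 := unitarymx_entry_le1 k b Pu.
have h3 := dbound k.
have p1 := normc_ge0 (P k a); have p2 := normc_ge0 (P k b).
have p3 := normc_ge0 (d 0 k - 1).
apply: le_trans h3; rewrite -mulrA mulrCA ler_piMr //.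
by apply: mulr_ile1.
Qed.

(** Positivity on the difference of [e_i] and a suitable phase times [e_j] gives
    [2 |M i j| <= M i i + M j j], and diagonal entries are at most the trace. *)
Lemma psdmx_entry_le1 (n : nat) (M : 'M[C]_n) (i j : 'I_n) :
  psdmx M -> \tr M = 1 -> normc (M i j) <= 1.
Proof.
move=> [/is_hermitianmxP]; rewrite scale1r => Mh Mp trM.
have form (a b : C) k l : (a *: delta_mx 0 k + b *: delta_mx 0 l : 'rV[C]_n) *m M
    *m (a *: delta_mx 0 k + b *: delta_mx 0 l) ^t* =
   ((a * a^* * M k k + b * b^* * M l l + a * b^* * M k l + b * a^* * M l k)%:M : 'M[C]_1).
  rewrite linearD !linearZ /= map_mxD !map_mxZ /= !trmx_delta !map_delta_mx.
  rewrite mulmxDl mulmxDr !mulmxDl -!scalemxAl -!scalemxAr -!rowE.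
  apply/matrixP => x y; rewrite !ord1 -!colE !mxE eqxx mulr1n; ring.
have diag k : 0 <= M k k.
  have := Mp (1 *: delta_mx 0 k + 0 *: delta_mx 0 k).
  by rewrite form mxE eqxx mulr1n conjC1 conjC0 !mul1r !mulr0 !mul0r !addr0.
have diag1 k : M k k <= 1.
  rewrite -trM /mxtrace (bigD1 k) //= lerDl; apply: sumr_ge0 => l _; exact: diag.
rewrite -lecR -norm_normc.
have [->|M0] := eqVneq (M i j) 0.
  by rewrite normr0; exact: ler01.
(* The phase of [M i j] makes both cross terms equal to minus its modulus. *)
have := Mp (1 *: delta_mx 0 i + (- (M i j / `|M i j|)) *: delta_mx 0 j).
rewrite form mxE eqxx mulr1n conjC1 !mul1r mulr1.
have -> : M j i = (M i j)^* by rewrite {1}Mh !mxE.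
rewrite rmorphN rmorphM fmorphV /= conj_normC.
have nM0 : `|M i j| != 0 by rewrite normr_eq0.
have -> : M i i + - (M i j / `|M i j|) * - ((M i j)^* / `|M i j|) * M j j +
   - ((M i j)^* / `|M i j|) * M i j + - (M i j / `|M i j|) * (M i j)^* =
   M i i + (M i j * (M i j)^* ) / `|M i j| ^+ 2 * M j j - (M i j * (M i j)^* / `|M i j|) *+ 2.
  by field.
rewrite -normCK divff ?expf_neq0 // mul1r expr2 mulfK // subr_ge0 => h.
have : `|M i j| *+ 2 <= 1 *+ 2 by apply: (le_trans h); rewrite mulr2n lerD.
by rewrite lerMn2r.
Qed.

End Gram.

(** * Estimates at a fixed point *)

Section NearTrace.
Local Open Scope sesquilinear_scope.
Variables (R : realType) (G : sgraph) (D : nat) (A : peps R G D).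
Local Notation C := R[i].
Local Notation normc := (@ComplexField.Normc.normc R).

Lemma trace_tens (I : finType) (Y : I -> 'M[C]_D) : \tr (tens Y) = \prod_n \tr (Y n).
Proof.
rewrite /mxtrace bigA_distr_bigA /= [RHS](reindex (@enum_val _ predT)) /=; last first.
  exact/onW_bij/enum_val_bij.
by apply: eq_bigr => a _; rewrite mxE.
Qed.

(** By cyclicity the double layer is the trace of the Gram matrix times [tens Y]. Subtracting the
    trace of [tens Y] leaves a double sum over a basis of at most [D ^ #|nbr v|] elements, in which
    the Gram deviation is bounded by [e] and the entries of [tens Y] by [b ^+ #|nbr v|]. *)
Lemma double_layer_near_trace (v : G) (e b : R) (Y : nbr v -> 'M[C]_D) :
  (forall a c, normc (((site A v) ^t* *m site A v) a c - (a == c)%:R) <= e) ->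
  (forall n i j, normc (Y n i j) <= b) ->
  normc (double_layer A (tens Y) - \prod_n \tr (Y n)) <=
    (D ^ #|nbr v|)%:R ^+ 2 * (e * b ^+ #|nbr v|).
Proof.
move=> He Hb; rewrite -trace_tens /double_layer mxtrace_mulC mulmxA.
rewrite -raddfB /= -[X in _ - X]mul1mx -mulmxBl.
have -> : (D ^ #|nbr v|)%N = #|'I_#|{ffun nbr v -> 'I_D}| |.
  by rewrite card_ord card_ffun card_ord.
rewrite expr2 -mulrA.
apply: normc_sum_le => a; rewrite mxE; apply: normc_sum_le => c.
rewrite ComplexField.Normc.normcM ler_pM ?normc_ge0 //.
  by move: (He a c); rewrite !mxE.
rewrite mxE normc_prod -[b ^+ _]prodr_const; apply: ler_prod => n _.
by rewrite normc_ge0 Hb.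
Qed.

End NearTrace.

(** * Bounds on messages, cut operators and loop vertices *)

Section FixedPoint.
Variables (R : realType) (G : sgraph) (D : nat) (A : peps R G D).
Local Notation C := R[i].
Local Notation X := ('I_D * 'I_D)%type.
Local Notation normc := (@ComplexField.Normc.normc R).
Variables (mu : dart G -> 'M[C]_D) (eta : R).
Hypothesis D_gt0 : (0 < D)%N.
Hypothesis mu_bp : bp_fixed_point A mu.
(** The bound [3 * D%:R] covers everything placed on a leg: messages and matrix units have entries
    at most 1, and the entries of [perp_factor] reach at most [3 * D%:R]. *)
Hypothesis near : forall (v : G) (Y : nbr v -> 'M[C]_D),
  (forall n i j, normc (Y n i j) <= 3 * D%:R) ->
  normc (double_layer A (tens Y) - \prod_n \tr (Y n)) <= eta.
Hypothesis eta_small : 26 * D%:R ^+ 3 * eta <= 1.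

Let d : R := D%:R.
Local Notation I d := (bondpair (mu d) (mu (flip d))).

Let d_ge1 : 1 <= d.
Proof. by rewrite /d ler1n. Qed.

Let le1_3d (x : R) : x <= 1 -> x <= 3 * D%:R.
Proof. by move=> h; apply: (le_trans h); move: d_ge1; rewrite /d; lra. Qed.

(** A vertex is taken as argument because [near] says nothing about [eta] on the empty graph. *)
Lemma eta_ge0 : G -> 0 <= eta.
Proof.
move=> v; apply: le_trans (near (v := v) (Y := fun=> 0) _); first exact: normc_ge0.
by move=> n i j; rewrite mxE ComplexField.Normc.normc0 le1_3d // ler01.
Qed.

Lemma message_entry_le1 e i j : normc (mu e i j) <= 1.
Proof. by have [/(_ e)[? ?] _] := mu_bp; exact: psdmx_entry_le1. Qed.

Lemma message_trace e : \tr (mu e) = 1.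
Proof. by have [/(_ e)[]] := mu_bp. Qed.

Lemma eta_bounds (v : G) :
  [/\ 0 <= eta, 26 * eta <= 1, 26 * d * eta <= 1 & 26 * d ^+ 3 * eta <= 1].
Proof.
have e0 := eta_ge0 v.
have d3 : d <= d ^+ 3 by rewrite ler_eXnr.
have h : 26 * d ^+ 3 * eta <= 1 by [].
have h1 : 26 * d * eta <= 1.
  by apply: le_trans h; rewrite ler_wpM2r // ler_wpM2l.
split=> //; apply: le_trans h1; rewrite ler_wpM2r //; move: d_ge1; lra.
Qed.

Lemma double_layer_message_near1 (v : G) :
  normc (double_layer A (tens (fun n : nbr v => mu (flip (leg n)))) - 1) <= eta.
Proof.
have -> : 1 = \prod_(n : nbr v) \tr (mu (flip (leg n))).
  by rewrite big1 // => n _; rewrite message_trace.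
by apply: near => n i j; rewrite le1_3d // message_entry_le1.
Qed.

Lemma double_layer_message_ge (v : G) :
  2^-1 <= normc (double_layer A (tens (fun n : nbr v => mu (flip (leg n))))).
Proof.
have := double_layer_message_near1 v; set x := double_layer _ _ => h.
have [_ h26 _ _] := eta_bounds v.
have := normcB x (x - 1); rewrite subKr ComplexField.Normc.normc1.
by lra.
Qed.

(** The matrix unit on leg [n] has trace [(i == j)%:R], and the messages on the other legs have
    trace 1. *)
Lemma Phi_near_identity (v : G) (n : nbr v) i j :
  normc (Phi A n (fun m => mu (flip (leg m))) i j - (i == j)%:R) <= eta.
Proof.
rewrite mxE.
have -> : (i == j)%:R = \prod_(m : nbr v)
    \tr (set_leg n (fun m => mu (flip (leg m))) (delta_mx i j) m) :> C.
  rewrite (bigD1 n) //= {1}/set_leg eqxx big1 ?mulr1; last first.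
    by move=> m /negbTE mn; rewrite /set_leg mn message_trace.
  rewrite /mxtrace (bigD1 i) //= mxE eqxx /= big1 ?addr0 // => k /negbTE ki.
  by rewrite mxE ki.
apply: near => m k l; apply: le1_3d; rewrite /set_leg; case: ifP => _.
  by rewrite mxE normc_bool_le1.
exact: message_entry_le1.
Qed.

(** The message is [P / \tr P] with [P] within [eta] of the identity entrywise and [\tr P] within
    [d * eta] of [d]. Over the common denominator the numerator is at most [2 * d * eta] and the
    denominator at least [d / 2], which gives 4. *)
Lemma message_near_uniform (e : dart G) i j :
  normc (d%:C * mu e i j - (i == j)%:R) <= 4 * eta.
Proof.
rewrite -(nbr_ofK e); set n := nbr_of e.
have [_ /(_ _ n)] := mu_bp; set P := Phi _ _ _ => /= ->.
have [e0 e1 e2 e3] := eta_bounds (src e).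
have d1 := d_ge1.
have HP k l : normc (P k l - (k == l)%:R) <= eta := Phi_near_identity n k l.
have trP : normc (\tr P - d%:C) <= d * eta.
  have -> : \tr P - d%:C = \sum_k (P k k - (k == k)%:R).
    rewrite sumrB; congr (_ - _); under eq_bigr do rewrite eqxx.
    by rewrite sumr_const card_ord rmorph_nat.
  have -> : d = #|'I_D|%:R by rewrite card_ord.
  by apply: normc_sum_le.
have nd : normc d%:C = d by rewrite rmorph_nat normc_nat.
have trge : d / 2 <= normc (\tr P).
  have : d <= normc (\tr P) + normc (\tr P - d%:C).
    by have := normcB (\tr P) (\tr P - d%:C); rewrite subKr nd.
  by nra.
have t0 : \tr P != 0.
  apply/eqP => t0; move: trge; rewrite t0 ComplexField.Normc.normc0; lra.
have -> : d%:C * ((\tr P)^-1 *: P) i j - (i == j)%:R =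
    (d%:C * (P i j - (i == j)%:R) - (i == j)%:R * (\tr P - d%:C)) / \tr P.
  by rewrite mxE; field.
rewrite ComplexField.Normc.normcM ComplexField.Normc.normcV ler_pdivrMr; last lra.
apply: (le_trans (normcB _ _)); rewrite !ComplexField.Normc.normcM nd.
have b1 := normc_bool_le1 R (i == j).
have b0 := normc_ge0 ((i == j)%:R : C); have t1 := normc_ge0 (\tr P - d%:C).
have hP := HP i j; have hP0 := normc_ge0 (P i j - (i == j)%:R).
have x1 : d * normc (P i j - (i == j)%:R) <= d * eta by rewrite ler_wpM2l //; lra.
have x2 : normc ((i == j)%:R : C) * normc (\tr P - d%:C) <= d * eta.
  by apply: le_trans trP; rewrite ler_piMl.
have x3 : 4 * eta * (d / 2) <= 4 * eta * normc (\tr P) by rewrite ler_wpM2l //; lra.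
by lra.
Qed.

Lemma sum_diagonal (f : X -> C) :
  \sum_(x : X) (x.1 == x.2)%:R * f x = \sum_i f (i, i).
Proof.
rewrite (eq_bigr (fun x => (x.1 == x.2)%:R * f (x.1, x.2))); last by case.
rewrite -(pair_bigA _ (fun i j : 'I_D => (i == j)%:R * f (i, j))) /=.
apply: eq_bigr => i _; rewrite (bigD1 i) //= eqxx mul1r big1 ?addr0 // => j.
by rewrite eq_sym => /negbTE ->; rewrite mul0r.
Qed.

Lemma card_bond_index : #|{: X}|%:R = d ^+ 2.
Proof. by rewrite card_prod card_ord natrM. Qed.

Let norm_d : normc d%:C = d.
Proof. by rewrite rmorph_nat normc_nat. Qed.

(** Two exactly uniform messages pair to [1 / d]. The errors move [d ^+ 2] times the pairing by at
    most [12 * d ^+ 2 * eta], which [eta_small] keeps below [d / 2]. *)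
Lemma edge_norm_ge (e : dart G) : (2 * d)^-1 <= normc (I e).
Proof.
have [e0 e1 e2 e3] := eta_bounds (src e).
have d1 := d_ge1.
have close : normc (d%:C ^+ 2 * I e - d%:C) <= d ^+ 2 * (12 * eta).
  have -> : d%:C ^+ 2 * I e - d%:C = \sum_(x : X)
     (d%:C * mu e x.1 x.2 * (d%:C * mu (flip e) x.1 x.2) - (x.1 == x.2)%:R * 1).
    rewrite sumrB sum_diagonal sumr_const card_ord rmorph_nat bondpairE mulr_sumr.
    by congr (_ - _); apply: eq_bigr => x _; ring.
  rewrite -card_bond_index; apply: normc_sum_le => x.
  have h1 := message_near_uniform e x.1 x.2.
  have h2 := message_near_uniform (flip e) x.1 x.2.
  move: h1 h2; set b : C := (_ == _)%:R; set y := d%:C * _; set y' := d%:C * _ => h1 h2.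
  (* As [b] is 0 or 1, [b * b = b]. Each of the three terms is at most [4 * eta], the quadratic one
     because [4 * eta <= 1]. *)
  have -> : y * y' - b * 1 = (y - b) * (y' - b) + (y - b) * b + b * (y' - b).
    have bb : b * b = b by rewrite /b; case: eqP => _; rewrite ?mulr1 ?mulr0.
    by rewrite mulr1 -{1}bb; ring.
  have b1 : normc b <= 1 := normc_bool_le1 _ _.
  move: (normc_ge0 b) (normc_ge0 (y - b)) (normc_ge0 (y' - b)) => b0 p1 p2.
  have := normcD ((y - b) * (y' - b) + (y - b) * b) (b * (y' - b)).
  have := normcD ((y - b) * (y' - b)) ((y - b) * b).
  rewrite !ComplexField.Normc.normcM => h3 h4; apply: (le_trans h4).
  have : normc (y - b) * normc (y' - b) <= 4 * eta * 1.
    by apply: ler_pM => //; apply: (le_trans h2); lra.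
  have : normc (y - b) * normc b <= 4 * eta * 1 by apply: ler_pM.
  have : normc b * normc (y' - b) <= 1 * (4 * eta) by apply: ler_pM.
  by lra.
have := normcB (d%:C ^+ 2 * I e) (d%:C ^+ 2 * I e - d%:C).
rewrite subKr norm_d ComplexField.Normc.normcM expr2 ComplexField.Normc.normcM norm_d.
move=> h; rewrite -div1r ler_pdivrMr; last by lra.
have dde : 26 * d * eta * d <= 1 * d by rewrite ler_wpM2r //; lra.
have h5 : 1 / 2 * d <= d * normc (I e) * d by move: close; rewrite expr2; lra.
by move: h5; rewrite ler_pM2r; [lra|lra].
Qed.

Lemma edge_norm_neq0 (e : dart G) : I e != 0.
Proof.
apply/eqP => I0; have := edge_norm_ge e; have := d_ge1.
rewrite I0 ComplexField.Normc.normc0 invr_le0; lra.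
Qed.

Lemma edge_norm_le (e : dart G) : normc (I e) <= d ^+ 2.
Proof.
rewrite bondpairE -[d ^+ 2]mulr1 -card_bond_index; apply: normc_sum_le => x.
by rewrite ComplexField.Normc.normcM mulr_ile1 ?normc_ge0 ?message_entry_le1.
Qed.

(** The matrix unit contributes at most [1 <= d], the subtracted multiple of the message at most
    [1 / |I e| <= 2 * d]. *)
Lemma perp_factor_entry_le (e : dart G) (z : X) i j :
  normc (perp_factor mu e z i j) <= 3 * d.
Proof.
rewrite !mxE; apply: (le_trans (normcB _ _)).
have -> : 3 * d = d + 2 * d by ring.
apply: lerD; first by apply: le_trans d_ge1; exact: normc_bool_le1.
rewrite !ComplexField.Normc.normcM ComplexField.Normc.normcV.
rewrite -mulrA mulrCA -[leRHS]mulr1; apply: ler_pM; rewrite ?mulr_ge0 ?invr_ge0 ?normc_ge0 //.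
  rewrite -[leRHS]invrK lef_pV2 ?edge_norm_ge // posrE.
    by apply: lt_le_trans (edge_norm_ge e); rewrite invr_gt0; have := d_ge1; lra.
  by rewrite invr_gt0; have := d_ge1; lra.
by rewrite mulr_ile1 ?normc_ge0 ?message_entry_le1.
Qed.

(* Being orthogonal to the message, the factor is nearly orthogonal to the
   identity, to which the rescaled message is close. *)
Lemma perp_factor_trace_le (e : dart G) (z : X) :
  normc (\tr (perp_factor mu e z)) <= 12 * d ^+ 3 * eta.
Proof.
set Q := perp_factor _ _ _.
have -> : \tr Q = \sum_(x : X) - ((d%:C * mu e x.1 x.2 - (x.1 == x.2)%:R) * Q x.1 x.2).
  have := bondpair_perp_factor z (edge_norm_neq0 e); rewrite bondpairE -/Q => b0.
  rewrite -[LHS]subr0 -[X in _ - X = _](mulr0 d%:C) -[X in _ - d%:C * X = _]b0 mulr_sumr.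
  rewrite /mxtrace -(sum_diagonal (fun x => Q x.1 x.2)) -sumrB.
  by apply: eq_bigr => x _; ring.
have -> : 12 * d ^+ 3 * eta = d ^+ 2 * (4 * eta * (3 * d)) by ring.
rewrite -card_bond_index; apply: normc_sum_le => x.
rewrite normc_opp ComplexField.Normc.normcM.
by apply: ler_pM; rewrite ?normc_ge0 ?message_near_uniform ?perp_factor_entry_le.
Qed.

Variable F : {set {set G}}.

(** The leg [n] has trace at most [12 * d ^+ 3 * eta], the other legs trace at most 1, and replacing
    the double layer by the product of traces costs another [eta <= d ^+ 3 * eta]. *)
Lemma loop_tensor_vertex_le (v : G) (n : nbr v) (z : {ffun dart G -> X}) :
  edge_of (leg n) \in F ->
  normc (double_layer A (tens (fun m : nbr v => loop_tensor mu F z (leg m)))) <=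
    13 * d ^+ 3 * eta.
Proof.
move=> nF; set w := fun _ => _.
have [e0 e1 e2 e3] := eta_bounds v.
have d1 := d_ge1.
have nearw : normc (double_layer A (tens w) - \prod_m \tr (w m)) <= eta.
  apply: near => m i j; rewrite /w /loop_tensor; case: ifP => _.
    exact: perp_factor_entry_le.
  by rewrite le1_3d // message_entry_le1.
have trw m : normc (\tr (w m)) <= 1.
  rewrite /w /loop_tensor; case: ifP => _; last first.
    by rewrite message_trace ComplexField.Normc.normc1.
  apply: (le_trans (perp_factor_trace_le _ _)); lra.
have prodw : normc (\prod_m \tr (w m)) <= 12 * d ^+ 3 * eta.
  rewrite normc_prod (bigD1 n) //= -[leRHS]mulr1; apply: ler_pM.
  - exact: normc_ge0.
  - by apply: prodr_ge0 => m _; exact: normc_ge0.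
  - by rewrite /w /loop_tensor nF perp_factor_trace_le.
  - by apply: prodr_ile1 => m _; rewrite normc_ge0 trw.
rewrite -[X in normc X](subrK (\prod_m \tr (w m))).
apply: (le_trans (normcD _ _)).
have : eta <= d ^+ 3 * eta by rewrite ler_peMl // exprn_ege1.
lra.
Qed.

Lemma loop_tensor_ratio_le (v : G) (n : nbr v) (z : {ffun dart G -> X}) :
  edge_of (leg n) \in F ->
  normc (double_layer A (tens (fun m : nbr v => loop_tensor mu F z (leg m))) /
         double_layer A (tens (fun m : nbr v => mu (flip (leg m))))) <=
    26 * d ^+ 3 * eta.
Proof.
move=> nF; have h1 := double_layer_message_ge v.
have h2 := loop_tensor_vertex_le z nF.
have [e0 e1 e2 e3] := eta_bounds v.
have d1 := d_ge1.
rewrite ComplexField.Normc.normcM ComplexField.Normc.normcV.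
rewrite ler_pdivrMr; last by apply: lt_le_trans h1; rewrite invr_gt0.
apply: (le_trans h2).
have : 26 * d ^+ 3 * eta * 2^-1 <= 26 * d ^+ 3 * eta *
  normc (double_layer A (tens (fun m : nbr v => mu (flip (leg m))))).
  by rewrite ler_wpM2l // mulr_ge0 // mulr_ge0 // exprn_ge0 // (le_trans ler01).
lra.
Qed.

Lemma loop_tensor_ratio1 (v : G) (z : {ffun dart G -> X}) :
  (forall n : nbr v, edge_of (leg n) \notin F) ->
  double_layer A (tens (fun m : nbr v => loop_tensor mu F z (leg m))) /
  double_layer A (tens (fun m : nbr v => mu (flip (leg m)))) = 1.
Proof.
move=> nF; rewrite (@eq_tens _ _ _ _ (fun m : nbr v => mu (flip (leg m)))); last first.
  by move=> m; rewrite /loop_tensor (negbTE (nF m)).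
rewrite divff //; apply/eqP => e0; have := double_layer_message_ge v.
rewrite e0 ComplexField.Normc.normc0; lra.
Qed.

Lemma card_oriented_le :
  (#|[pred e : dart G | oriented e && (edge_of e \in F)]| <= #|F|)%N.
Proof.
rewrite -(@card_in_image _ _ (@edge_of G)); last first.
  move=> e e' /andP[oe _] /andP[oe' _]; exact: oriented_edge_inj.
by apply/subset_leq_card/subsetP => f /imageP[e /andP[_ eF] ->].
Qed.

(** Each loop edge costs [d ^+ 2] for the factor [I e] and [d ^+ 2] for the choices of its middle
    index; each vertex of [W] gains [26 * d ^+ 3 * eta], and the others contribute 1. *)
Lemma normc_loop_activity_le (W : {set G}) : is_loop W F ->
  normc (loop_activity A mu F) <=
    (d ^+ 4) ^+ #|F| * (26 * d ^+ 3 * eta) ^+ #|W|.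
Proof.
move=> [[Fe FW] [W0 _] degW].
have d1 := d_ge1.
pose x0 : X := (Ordinal D_gt0, Ordinal D_gt0).
rewrite (loop_activityE _ F x0 edge_norm_neq0) ComplexField.Normc.normcM.
set P := [pred e : dart G | _].
have Pexp (b : R) : 1 <= b -> b ^+ #|P| <= b ^+ #|F|.
  by move=> b1; rewrite ler_weXn2l // card_oriented_le.
have d2 : 1 <= d ^+ 2 by rewrite exprn_ege1.
have prodI : normc (\prod_(e | oriented e && (edge_of e \in F)) I e) <= (d ^+ 2) ^+ #|F|.
  apply: le_trans (Pexp _ d2); rewrite normc_prod -[leRHS]prodr_const.
  by apply: ler_prod => e _; rewrite normc_ge0 edge_norm_le.
have -> : (d ^+ 4) ^+ #|F| = (d ^+ 2) ^+ #|F| * (d ^+ 2) ^+ #|F|.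
  by rewrite -exprMn -exprD.
rewrite -mulrA; apply: ler_pM; rewrite ?normc_ge0 //.
apply: (@le_trans _ _ (#|pffun_on x0 P predT|%:R * (26 * d ^+ 3 * eta) ^+ #|W|)).
  apply: (le_trans (normc_sum _ _)); rewrite mulr_natl -sumr_const.
  apply: ler_sum => z _; rewrite normc_prod (bigID (mem W)) /=.
  rewrite [X in _ * X]big1 ?mulr1; last first.
    move=> v vW; rewrite loop_tensor_ratio1 ?ComplexField.Normc.normc1 // => n.
    by apply: contra vW => /FW/subsetP; apply; rewrite !inE eqxx.
  rewrite -[leRHS]prodr_const; apply: ler_prod => v vW; rewrite normc_ge0 /=.
  have /card_gt0P[f] : (0 < degree_in F v)%N := ltnW (degW v vW).
  rewrite inE => /andP[fF vf].
  have /imsetP[e _ fe] : f \in edges G := subsetP Fe f fF.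
  (* The vertex is the source or the target of the dart [e], so its leg on the loop is [e] or
     [flip e]. *)
  move: vf; rewrite fe !inE => /orP[] /eqP ve.
    by subst v; apply: (@loop_tensor_ratio_le _ (nbr_of e)); rewrite nbr_ofK -fe.
  subst v; apply: (@loop_tensor_ratio_le _ (nbr_of (flip e))).
  by rewrite nbr_ofK edge_of_flip -fe.
rewrite card_pffun_on natrX card_bond_index.
have /set0Pn[v vW] := W0; have [e0 _ _ _] := eta_bounds v.
by rewrite ler_wpM2r ?Pexp // exprn_ge0 // mulr_ge0 // mulr_ge0 // exprn_ge0 // (le_trans ler01).
Qed.

End FixedPoint.

(** Every edge of [F] is among the at most [max_degree G] edges at some vertex of [W]. This turns
    smallness per vertex into decay per edge. *)
Lemma card_loop_edges_le (G : sgraph) (W : {set G}) (F : {set {set G}}) :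
  is_subgraph W F -> (#|F| <= max_degree G * #|W|)%N.
Proof.
move=> [Fe FW].
apply: (@leq_trans #|\bigcup_(v in W) [set edge_of (leg n) | n : nbr v]|).
  apply/subset_leq_card/subsetP => f fF.
  have /imsetP[e _ fe] : f \in edges G := subsetP Fe f fF.
  apply/bigcupP; exists (src e).
    by apply: (subsetP (FW f fF)); rewrite fe !inE eqxx.
  by apply/imsetP; exists (nbr_of e); rewrite ?nbr_ofK.
rewrite mulnC -sum_nat_const.
elim/big_rec2: _ => [|v n U _ leU]; first by rewrite cards0.
apply: (leq_trans (leq_card_setU _ _)); apply: leq_add leU.
apply: (leq_trans (leq_imset_card _ _)).
exact: (leq_bigmax (F := fun v : G => #|nbr v|)).
Qed.

(** * Choice of the threshold *)

Section Threshold.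
Variables (R : realType) (G : sgraph) (D Delta : nat) (A : peps R G D).
Local Notation normc := (@ComplexField.Normc.normc R).

(** Of the three powers of [D ^ Delta], two come from the double sum over basis elements and one
    from the Gram bound. Degrees are raised to [Delta], all bases being at least 1. *)
Lemma double_layer_near_trace_uniform (eps : R) (v : G) (Y : nbr v -> 'M[R[i]]_D) :
  (0 < D)%N -> max_degree G = Delta -> injectivity_parameter A eps ->
  (forall n i j, normc (Y n i j) <= 3 * D%:R) ->
  normc (double_layer A (tens Y) - \prod_n \tr (Y n)) <=
    (D ^ Delta)%:R ^+ 3 * (3 * D%:R) ^+ Delta * eps.
Proof.
move=> D0 degG [delta [/andP[d0 d1] -> sv]] hY.
have degv : (#|nbr v| <= Delta)%N.
  by rewrite -degG; exact: (leq_bigmax (F := fun v : G => #|nbr v|)).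
have D1 : 1 <= D%:R :> R by rewrite ler1n.
have eps0 : 0 <= 1 - delta ^+ 2 by rewrite subr_ge0 expr_le1 // ltW.
have cardN : (#|{ffun nbr v -> 'I_D}| <= D ^ Delta)%N.
  by rewrite card_ffun card_ord leq_pexp2l.
have dd : 0 <= delta <= 1 by rewrite ltW.
apply: (le_trans (double_layer_near_trace (gram_close_to_identity dd (sv v)) hY)).
have -> : (D ^ Delta)%:R ^+ 3 * (3 * D%:R) ^+ Delta * (1 - delta ^+ 2) =
    (D ^ Delta)%:R ^+ 2 * ((D ^ Delta)%:R * (1 - delta ^+ 2) * (3 * D%:R) ^+ Delta).
  by ring.
have b1 : 1 <= 3 * D%:R :> R by lra.
have b0 : 0 <= 3 * D%:R :> R by lra.
apply: ler_pM.
- by rewrite exprn_ge0.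
- by rewrite !mulr_ge0 // exprn_ge0.
- by rewrite lerXn2r ?nnegrE // ler_nat leq_pexp2l.
- apply: ler_pM; rewrite ?mulr_ge0 ?exprn_ge0 //.
    by rewrite ler_wpM2r // ler_nat.
  by rewrite ler_weXn2l.
Qed.

(** With [q] equal to [expR (- c) / D%:R ^+ 4], a loop vertex gains at most [q ^+ Delta]. Since
    [q <= 1] and [#|F| <= Delta * #|W|], the vertices together gain [q ^+ #|F|], whose denominator
    absorbs the cost of the edges. *)
Lemma loop_activity_decay (eps c : R) (mu : dart G -> 'M[R[i]]_D) W F :
  (0 < D)%N -> 0 <= c -> max_degree G = Delta ->
  injectivity_parameter A eps -> bp_fixed_point A mu ->
  26 * D%:R ^+ 3 * ((D ^ Delta)%:R ^+ 3 * (3 * D%:R) ^+ Delta * eps) <=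
    (expR (- c) / D%:R ^+ 4) ^+ Delta ->
  is_loop W F ->
  normc (loop_activity A mu F) <= expR (- c * #|F|%:R).
Proof.
move=> D0 c0 degG inj bp; set eta := (_ * eps); set q := (expR _ / _) => small loopF.
have D1 : 1 <= D%:R :> R by rewrite ler1n.
have D41 : 1 <= D%:R ^+ 4 :> R by rewrite exprn_ege1.
have D4 : 0 < D%:R ^+ 4 :> R by lra.
have q0 : 0 <= q by rewrite divr_ge0 ?expR_ge0 // ltW.
have q1 : q <= 1.
  by rewrite ler_pdivrMr // mul1r (le_trans _ D41) // -expR0 ler_expR oppr_le0.
have eta_small : 26 * D%:R ^+ 3 * eta <= 1 by apply: (le_trans small); exact: exprn_ile1.
have near (v : G) (Y : nbr v -> 'M_D) (hY : forall n i j, normc (Y n i j) <= 3 * D%:R) :=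
  double_layer_near_trace_uniform D0 degG inj hY.
apply: (le_trans (normc_loop_activity_le D0 bp near eta_small loopF)).
have [subF [/set0Pn[v _] _] _] := loopF.
have eta0 : 0 <= eta := eta_ge0 D0 near v.
apply: (@le_trans _ _ ((D%:R ^+ 4) ^+ #|F| * q ^+ #|F|)).
  rewrite ler_wpM2l ?exprn_ge0 //.
  apply: (@le_trans _ _ ((q ^+ Delta) ^+ #|W|)).
    by rewrite lerXn2r // nnegrE ?exprn_ge0 // mulr_ge0 // mulr_ge0 // exprn_ge0.
  by rewrite -exprM ler_wiXn2l // -degG card_loop_edges_le.
by rewrite -exprMn /q mulrC divfK ?gt_eqF // [- c * _]mulrC expRM_natl.
Qed.

End Threshold.

Theorem lemma1 (R : realType) :
  exists (K : R) (eps_thr : nat -> nat -> R),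
    0 < K /\
    forall D Delta : nat, (0 < D)%N -> (0 < Delta)%N ->
      [/\ 0 < eps_thr D Delta,
          eps_thr D Delta < (2 * Delta%:R - 1)^-1,
          eps_thr D Delta <=
            K * Num.min (D%:R^-1) ((D%:R / Delta%:R) `^ (Delta%:R / 2))
        & forall eps : R, eps < eps_thr D Delta ->
          exists c : R,
            ln (2 * expR 1 * Delta%:R) + 2^-1 < c /\
            forall (G : sgraph) (A : peps R G D)
                   (mu : dart G -> 'M[R[i]]_D),
              max_degree G = Delta ->
              normalized A ->
              injectivity_parameter A eps ->
              bp_fixed_point A mu ->
              forall (W : {set G}) (F : {set {set G}}),
                is_loop W F ->
                `|loop_activity A mu F| <= (expR (- c * #|F|%:R))%:C].
Proof.
(* The added 1 instead of [2^-1] makes the inequality for [c] strict. *)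
pose c (Delta : nat) : R := ln (2 * expR 1 * Delta%:R) + 1.
pose q (D Delta : nat) : R := expR (- c Delta) / D%:R ^+ 4.
pose k (D Delta : nat) : R :=
  26 * D%:R ^+ 3 * ((D ^ Delta)%:R ^+ 3 * (3 * D%:R) ^+ Delta).
(* The first term gives the smallness required by [loop_activity_decay], the second is halved for a
   strict inequality, and the last gives the asymptotic bound with [K = 1]. *)
pose thr (D Delta : nat) : R :=
  Num.min (q D Delta ^+ Delta / k D Delta)
   (Num.min ((2 * Delta%:R - 1)^-1 / 2)
     (Num.min (D%:R^-1) ((D%:R / Delta%:R) `^ (Delta%:R / 2)))).
exists 1, thr; split=> // D Delta D0 Delta0.
have D1 : 1 <= D%:R :> R by rewrite ler1n.
have Dp : 0 < D%:R :> R by lra.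
have Delta1 : 1 <= Delta%:R :> R by rewrite ler1n.
have k0 : 0 < k D Delta.
  rewrite !mulr_gt0 ?exprn_gt0 ?mulr_gt0 // ltr0n expn_gt0 D0 //.
have inv0 : 0 < (2 * Delta%:R - 1)^-1 :> R by rewrite invr_gt0; lra.
split.
- rewrite !lt_min !divr_gt0 ?exprn_gt0 ?divr_gt0 ?expR_gt0 ?exprn_gt0 //=.
  by rewrite invr_gt0 Dp powR_gt0 // divr_gt0 //; lra.
- rewrite (@le_lt_trans _ _ ((2 * Delta%:R - 1)^-1 / 2)) //.
    by rewrite !ge_min lexx orbT.
  by lra.
- by rewrite mul1r ge_min ge_min lexx !orbT.
move=> eps eps_thr; exists (c Delta); split; first by rewrite /c; lra.
move=> G A mu degG _ inj bp W F loopF.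
rewrite norm_normc lecR; apply: loop_activity_decay degG inj bp _ loopF => //.
  rewrite /c addr_ge0 // ln_ge0 //.
  have e1 := expR_ge1Dx (1 : R).
  have : 1 <= expR 1 * Delta%:R :> R by rewrite mulr_ege1 //; lra.
  lra.
have : eps <= q D Delta ^+ Delta / k D Delta.
  by apply/ltW/(lt_le_trans eps_thr); rewrite /thr ge_min lexx.
by rewrite ler_pdivlMr // mulrC /k !mulrA.
Qed.
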